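(* Let $\mathcal{U}_q(\widehat{\mathfrak g})$, the root lattice involution $\Theta$, the index $p(0)\in\{0,1,\dots,n\}$, the Hopf subalgebra $\mathcal{M}$, the group $\mathcal{T}_\Theta$, the set $\hat\pi^*$ and the elements $\tilde\theta(\xi^-_j)$ for $\alpha_j\in\hat\pi^*$ be as described in the context. Then, for suitable $d_j\in\mathbb{C}^\times$ ($\alpha_j\in\hat\pi^*$), the subalgebra $\mathcal{B}\subset\mathcal{U}_q(\widehat{\mathfrak g})$ generated by $\mathcal{M}$, $\mathcal{T}_\Theta$ and the elements $$B^-_j=\xi^-_jk_j-d_j\,\tilde\theta(\xi^-_j)\,k_j,\qquad \alpha_j\in\hat\pi^*,$$ is a left coideal subalgebra of $\mathcal{U}_q(\widehat{\mathfrak g})$, i.e. $\Delta(b)\in\mathcal{U}_q(\widehat{\mathfrak g})\otimes\mathcal{B}$ for all $b\in\mathcal{B}$.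
   Context: Let $\mathfrak g$ be a semisimple complex Lie algebra of rank $n$ with simple roots $\pi=\{\alpha_1,\dots,\alpha_n\}$, and let $\hat{\mathfrak g}$ be the (untwisted) affine Kac--Moody algebra with simple roots $\hat\pi=\{\alpha_0\}\cup\pi$, extended Cartan matrix $(\hat a_{ij})_{0\le i,j\le n}$, symmetrization $(\hat b_{ij})=(\hat r_i\hat a_{ij})$ with $\hat r_i$ coprime positive integers, and $\alpha_0=\delta-\vartheta$ with $\vartheta$ the highest root of $\mathfrak g$. Let $q\in\mathbb{C}^\times$ be transcendental and $q_i=q^{\hat r_i}$. $\mathcal{U}_q(\widehat{\mathfrak g})$ is the Drinfeld--Jimbo algebra generated by $\xi_i^\pm,k_i^{\pm1}$ ($0\le i\le n$) with relations $k_ik_j=k_jk_i$, $k_i\xi_j^\pm k_i^{-1}=q^{\pm\hat b_{ij}}\xi_j^\pm$, $[\xi_i^+,\xi_j^-]=\delta_{ij}\frac{k_i-k_i^{-1}}{q_i-q_i^{-1}}$ and the quantum Serre relations. It is a Hopf algebra with $$\Delta(k_i)=k_i\otimes k_i,\quad \Delta(\xi_i^+)=\xi_i^+\otimes1+k_i\otimes\xi_i^+,\quad \Delta(\xi_i^-)=\xi_i^-\otimes k_i^{-1}+1\otimes\xi_i^-,$$ $S(k_i)=k_i^{-1}$, $S(\xi_i^+)=-k_i^{-1}\xi_i^+$, $S(\xi_i^-)=-\xi_i^-k_i$, $\epsilon(k_i)=1$, $\epsilon(\xi_i^\pm)=0$. The right adjoint action is $(\mathrm{ad}_r\,\xi_i^+)a=k_i^{-1}a\xi_i^+-k_i^{-1}\xi_i^+a$,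 $(\mathrm{ad}_r\,\xi_i^-)a=a\xi_i^--\xi_i^-k_iak_i^{-1}$, and $(\mathrm{ad}_r\,x_1x_2\cdots x_r)a=(\mathrm{ad}_r\,x_1)\big((\mathrm{ad}_r\,x_2)\cdots((\mathrm{ad}_r\,x_r)a)\big)$ for generators $x_i$. Let $\mathcal{T}$ be the group generated by the $k_i^{\pm1}$ and $\tau:\bigoplus_{i=0}^n\mathbb{Z}\alpha_i\to\mathcal{T}$ the group isomorphism $\tau(\alpha_i)=k_i$. Let $\theta$ be an involution of the subalgebra $\tilde{\mathfrak g}\subset\hat{\mathfrak g}$ generated by the Chevalley generators, whose associated involution $\Theta$ of the root lattice satisfies, for some $p(0)\in\{0,\dots,n\}$, $$\Theta(\alpha_0)\in-\alpha_{p(0)}-\mathbb{Z}(\pi\setminus\{\alpha_{p(0)}\}),\qquad \Theta(\alpha_i)=\alpha_i\ \text{ for all }\alpha_i\in\pi\setminus\{\alpha_{p(0)}\},$$ and $\alpha_0-\Theta(\alpha_0)=k\delta$ with $k=1$ if $p(0)\ne0$ and $k=2$ if $p(0)=0$. Here $\pi\setminus\{\alpha_{p(0)}\}=\pi$ if $p(0)=0$. $\mathcal{M}$ is the Hopf subalgebra generated by $\xi_i^\pm,k_i^{\pm1}$ for $\alpha_i\in\pi\setminus\{\alpha_{p(0)}\}$; $\mathcal{T}_\Theta=\{\tau(\lambda):\Theta(\lambda)=\lambda\}$; $\hat\pi^*=\{\alpha_0,\alpha_{p(0)}\}$ if $p(0)\neq0$ and $\hat\pi^*=\{\alpha_0\}$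 if $p(0)=0$. There are roots $\alpha_{0_1},\dots,\alpha_{0_r}\in\pi\setminus\{\alpha_{p(0)}\}$ and positive integers $m_1,\dots,m_r$ with $\Theta(\alpha_0)=-\alpha_{p(0)}-\sum_km_k\alpha_{0_k}$ (those for which the assignment below extends to an algebra automorphism $\tilde\theta$ of $\mathcal{U}_q(\widehat{\mathfrak g})$ with $\tilde\theta(q)=q^{-1}$, $\tilde\theta(\xi_i^\pm)=\xi_i^\pm$ for $\alpha_i\in\pi\setminus\{\alpha_{p(0)}\}$ and $\tilde\theta(\tau(\lambda))=\tau(\Theta(-\lambda))$), and with $m_{(0)}=m_1+\dots+m_r$, $$\tilde\theta(\xi_0^-)=\big(\mathrm{ad}_r\,(\xi^+_{0_1})^{(m_1)}\cdots(\xi^+_{0_r})^{(m_r)}\big)\,k_{p(0)}^{-1}\xi^+_{p(0)},$$ $$\tilde\theta(\xi_{p(0)}^-)=(-1)^{m_{(0)}}\big(\mathrm{ad}_r\,(\xi^+_{0_r})^{(m_r)}\cdots(\xi^+_{0_1})^{(m_1)}\big)\,k_{0}^{-1}\xi^+_{0}$$ (for $p(0)=0$ the two formulas are equivalent and only the first is needed). Here $(\xi_i^+)^{(m)}$ denotes the $m$-th power of $\xi^+_i$ up to a fixed nonzero scalar normalization (a divided power). *)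

(* Defs.v *)
From HB Require Import structures.
From mathcomp Require Import all_boot all_order all_algebra.
From mathcomp Require Import boolp classical_sets.

Set Implicit Arguments.
Unset Strict Implicit.
Unset Printing Implicit Defensive.

Import Order.TTheory GRing.Theory Num.Theory.
Local Open Scope ring_scope.
Local Open Scope quotient_scope.

Definition is_subalgebra (K : fieldType) (A : algType K) (B : set A) : Prop :=
  [/\ B 1,
      forall (a : K) u v, B u -> B v -> B (a *: u + v) &
      forall u v, B u -> B v -> B (u * v)].

Definition generated_subalgebra (K : fieldType) (A : algType K) (S : set A) :
    set A :=
  smallest (@is_subalgebra K A) S.

(* Unification and conversion do not look inside terms locked with this key.  *)
Fact pres_key : unit. Proof. exact: tt. Qed.

Inductive alg_term (K X : Type) : Type :=
| alg_var of X
| alg_const of K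
| alg_add of alg_term K X & alg_term K X
| alg_mul of alg_term K X & alg_term K X.
Arguments alg_var {K X}.
Arguments alg_const {K X}.

Declare Scope alg_term_scope.
Delimit Scope alg_term_scope with T.
Bind Scope alg_term_scope with alg_term.
Notation "x + y" := (alg_add x y) : alg_term_scope.
Notation "x * y" := (alg_mul x y) : alg_term_scope.
Notation "c *: x" := (alg_mul (alg_const c) x) : alg_term_scope.
Notation "x - y" := (alg_add x (alg_mul (alg_const (-1)%R) y)) : alg_term_scope.
Notation "x ^+ l" := (iter l (alg_mul x) (alg_const 1%R)) : alg_term_scope.

Section AlgTermChoice.
Variables K X : Type.
HB.instance Definition _ := gen_eqMixin (alg_term K X).
HB.instance Definition _ := gen_choiceMixin (alg_term K X).
End AlgTermChoice.

Section PresentedAlgebra.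
Variables (K : fieldType) (X : Type).
Local Notation term := (alg_term K X).
Variable R : term -> term -> Prop.

(* presented_alg is the quotient of the free unital associative K-algebra on  *)
(* X by the relations R x y, read as x = y: alg_eqv is the congruence         *)
(* generated by R and the axioms of unital associative K-algebras.            *)
Inductive alg_eqv : term -> term -> Prop :=
| alg_refl x : alg_eqv x x
| alg_sym x y : alg_eqv x y -> alg_eqv y x
| alg_trans x y z : alg_eqv x y -> alg_eqv y z -> alg_eqv x z
| alg_congD x x' y y' :
    alg_eqv x x' -> alg_eqv y y' -> alg_eqv (x + y)%T (x' + y')%T
| alg_congM x x' y y' :
    alg_eqv x x' -> alg_eqv y y' -> alg_eqv (x * y)%T (x' * y')%T
| alg_addA x y z : alg_eqv (x + (y + z))%T (x + y + z)%T
| alg_addC x y : alg_eqv (x + y)%T (y + x)%T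
| alg_add0 x : alg_eqv (alg_const 0 + x)%T x
| alg_mulA x y z : alg_eqv (x * (y * z))%T (x * y * z)%T
| alg_mul1 x : alg_eqv (alg_const 1 * x)%T x
| alg_mul0 x : alg_eqv (alg_const 0 * x)%T (alg_const 0)
| alg_mulDl x y z : alg_eqv ((x + y) * z)%T (x * z + y * z)%T
| alg_mulDr x y z : alg_eqv (x * (y + z))%T (x * y + x * z)%T
| alg_constD a b : alg_eqv (alg_const (a + b)) (alg_const a + alg_const b)%T
| alg_constM a b : alg_eqv (alg_const (a * b)) (alg_const a * alg_const b)%T
| alg_constC a x : alg_eqv (alg_const a * x)%T (x * alg_const a)%T
| alg_rel x y : R x y -> alg_eqv x y.

Definition alg_eqb : rel term := fun x y => `[< alg_eqv x y >].

Lemma alg_eqb_equiv : equiv_class_of alg_eqb.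
Proof.
split=> [x|x y|y x z].
- exact/asboolP/alg_refl.
- by apply/asboolP/asboolP => /alg_sym.
- by move=> /asboolP xy /asboolP yz; apply/asboolP/(alg_trans xy yz).
Qed.

Canonical alg_eqb_rel := EquivRelPack alg_eqb_equiv.

Definition presented_alg : Type := {eq_quot alg_eqb}.
HB.instance Definition _ := Choice.on presented_alg.

Definition pres_class : term -> presented_alg :=
  locked_with pres_key (fun x => \pi_({eq_quot alg_eqb}) x).
Definition pres_repr : presented_alg -> term := locked_with pres_key repr.

Lemma pres_class_eq x y : pres_class x = pres_class y <-> alg_eqv x y.
Proof.
rewrite /pres_class locked_withE.
by split=> [/eqquotP/asboolP|?]; last exact/eqquotP/asboolP.
Qed.

Lemma pres_reprK u : pres_class (pres_repr u) = u.
Proof. by rewrite /pres_class /pres_repr !locked_withE reprK. Qed.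

Lemma pres_class_surj u : exists x, u = pres_class x.
Proof. by exists (pres_repr u); rewrite pres_reprK. Qed.

Lemma pres_repr_eqv x : alg_eqv x (pres_repr (pres_class x)).
Proof. by apply/pres_class_eq; rewrite pres_reprK. Qed.

Definition pres_add : presented_alg -> presented_alg -> presented_alg :=
  locked_with pres_key (fun u v => pres_class (pres_repr u + pres_repr v)%T).
Definition pres_mul : presented_alg -> presented_alg -> presented_alg :=
  locked_with pres_key (fun u v => pres_class (pres_repr u * pres_repr v)%T).
Definition pres_scale : K -> presented_alg -> presented_alg :=
  locked_with pres_key (fun a u => pres_class (a *: pres_repr u)%T).
Definition pres_opp (u : presented_alg) := pres_scale (-1) u.

Lemma pres_addE x y : pres_add (pres_class x) (pres_class y) = pres_class (x + y)%T.
Proof.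
rewrite /pres_add locked_withE; apply/pres_class_eq/alg_congD; apply/alg_sym/pres_repr_eqv.
Qed.

Lemma pres_mulE x y : pres_mul (pres_class x) (pres_class y) = pres_class (x * y)%T.
Proof.
rewrite /pres_mul locked_withE; apply/pres_class_eq/alg_congM; apply/alg_sym/pres_repr_eqv.
Qed.

Lemma pres_scaleE a x : pres_scale a (pres_class x) = pres_class (a *: x)%T.
Proof.
rewrite /pres_scale locked_withE; apply/pres_class_eq/alg_congM; first exact: alg_refl.
exact/alg_sym/pres_repr_eqv.
Qed.

Local Notation pres_opE := (pres_addE, pres_mulE, pres_scaleE).

Lemma pres_addA : associative pres_add.
Proof.
move=> u v w; have [[x ->] [y ->] [z ->]] :=
  And3 (pres_class_surj u) (pres_class_surj v) (pres_class_surj w).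
rewrite !pres_opE; exact/pres_class_eq/alg_addA.
Qed.

Lemma pres_addC : commutative pres_add.
Proof.
move=> u v; have [[x ->] [y ->]] := conj (pres_class_surj u) (pres_class_surj v).
rewrite !pres_opE; exact/pres_class_eq/alg_addC.
Qed.

Lemma pres_add0 : left_id (pres_class (alg_const 0)) pres_add.
Proof.
move=> u; have [x ->] := pres_class_surj u.
rewrite !pres_opE; exact/pres_class_eq/alg_add0.
Qed.

Lemma pres_scale1 : left_id 1 pres_scale.
Proof.
move=> u; have [x ->] := pres_class_surj u.
rewrite !pres_opE; exact/pres_class_eq/alg_mul1.
Qed.

Lemma pres_scale0 u : pres_scale 0 u = pres_class (alg_const 0).
Proof.
have [x ->] := pres_class_surj u; rewrite !pres_opE.
exact/pres_class_eq/alg_mul0.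
Qed.

Lemma pres_scaleDl u : {morph pres_scale^~ u : a b / a + b >-> pres_add a b}.
Proof.
move=> a b; have [x ->] := pres_class_surj u; rewrite /= !pres_opE.
apply/pres_class_eq; apply: alg_trans (alg_mulDl _ _ _).
exact: alg_congM (alg_constD _ _) (alg_refl _).
Qed.

Lemma pres_addN : left_inverse (pres_class (alg_const 0)) pres_opp pres_add.
Proof.
by move=> u; rewrite /pres_opp -{2}[u]pres_scale1 -pres_scaleDl addNr pres_scale0.
Qed.

HB.instance Definition _ := GRing.isZmodule.Build presented_alg
  pres_addA pres_addC pres_add0 pres_addN.

Lemma pres_mulA : associative pres_mul.
Proof.
move=> u v w; have [[x ->] [y ->] [z ->]] :=
  And3 (pres_class_surj u) (pres_class_surj v) (pres_class_surj w).
rewrite !pres_opE; exact/pres_class_eq/alg_mulA.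
Qed.

Lemma pres_mul1 : left_id (pres_class (alg_const 1)) pres_mul.
Proof.
move=> u; have [x ->] := pres_class_surj u.
rewrite !pres_opE; exact/pres_class_eq/alg_mul1.
Qed.

Lemma pres_1mul : right_id (pres_class (alg_const 1)) pres_mul.
Proof.
move=> u; have [x ->] := pres_class_surj u; rewrite !pres_opE; apply/pres_class_eq.
exact: alg_trans (alg_sym (alg_constC _ _)) (alg_mul1 _).
Qed.

Lemma pres_mulDl : left_distributive pres_mul pres_add.
Proof.
move=> u v w; have [[x ->] [y ->] [z ->]] :=
  And3 (pres_class_surj u) (pres_class_surj v) (pres_class_surj w).
rewrite !pres_opE; exact/pres_class_eq/alg_mulDl.
Qed.

Lemma pres_mulDr : right_distributive pres_mul pres_add.
Proof.
move=> u v w; have [[x ->] [y ->] [z ->]] :=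
  And3 (pres_class_surj u) (pres_class_surj v) (pres_class_surj w).
rewrite !pres_opE; exact/pres_class_eq/alg_mulDr.
Qed.

HB.instance Definition _ := GRing.Zmodule_isPzRing.Build presented_alg
  pres_mulA pres_mul1 pres_1mul pres_mulDl pres_mulDr.

Lemma pres_scaleA a b u : pres_scale a (pres_scale b u) = pres_scale (a * b) u.
Proof.
have [x ->] := pres_class_surj u; rewrite !pres_opE; apply/pres_class_eq.
apply: alg_trans (alg_mulA _ _ _) _.
exact: alg_congM (alg_sym (alg_constM _ _)) (alg_refl _).
Qed.

Lemma pres_scaleDr : right_distributive pres_scale pres_add.
Proof.
move=> a u v; have [[x ->] [y ->]] := conj (pres_class_surj u) (pres_class_surj v).
rewrite !pres_opE; exact/pres_class_eq/alg_mulDr.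
Qed.

HB.instance Definition _ := GRing.Zmodule_isLmodule.Build K presented_alg
  pres_scaleA pres_scale1 pres_scaleDr pres_scaleDl.

Lemma pres_scalerAl (a : K) (u v : presented_alg) : a *: (u * v) = (a *: u) * v.
Proof.
have [[x ->] [y ->]] := conj (pres_class_surj u) (pres_class_surj v).
rewrite /GRing.mul /GRing.scale /= !pres_opE; exact/pres_class_eq/alg_mulA.
Qed.

Lemma pres_scalerAr (a : K) (u v : presented_alg) : a *: (u * v) = u * (a *: v).
Proof.
have [[x ->] [y ->]] := conj (pres_class_surj u) (pres_class_surj v).
rewrite /GRing.mul /GRing.scale /= !pres_opE; apply/pres_class_eq.
apply: alg_trans (alg_mulA _ _ _) _; apply: alg_trans (alg_sym (alg_mulA _ _ _)).
exact: alg_congM (alg_constC _ _) (alg_refl _).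
Qed.

Definition pres_gen (x : X) : presented_alg := pres_class (alg_var x).

Lemma pres_classD x y : pres_class (x + y)%T = pres_class x + pres_class y.
Proof. exact/esym/pres_addE. Qed.

Lemma pres_classM x y : pres_class (x * y)%T = pres_class x * pres_class y.
Proof. exact/esym/pres_mulE. Qed.

Lemma pres_classZ a x : pres_class (a *: x)%T = a *: pres_class x.
Proof. exact/esym/pres_scaleE. Qed.

Lemma pres_class0 : pres_class (alg_const 0) = 0.
Proof. by []. Qed.

Lemma pres_class1 : pres_class (alg_const 1) = 1.
Proof. by []. Qed.

Lemma pres_classN x : pres_class ((-1) *: x)%T = - pres_class x.
Proof. by rewrite pres_classZ scaleN1r. Qed.

Lemma pres_class_rel x y : R x y -> pres_class x = pres_class y.
Proof. by move=> Rxy; apply/pres_class_eq/alg_rel. Qed.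

(* Characters of presented_alg; they are only used to show that the algebras  *)
(* below are nonzero, as algType requires.                                    *)
Section Characters.
Variable eps : X -> K.

Fixpoint term_char (x : term) : K :=
  match x with
  | alg_var x => eps x
  | alg_const a => a
  | alg_add x y => term_char x + term_char y
  | alg_mul x y => term_char x * term_char y
  end.

Hypothesis eps_rel : forall x y, R x y -> term_char x = term_char y.

Lemma term_char_eqv x y : alg_eqv x y -> term_char x = term_char y.
Proof.
elim=> //= {x y}.
- by move=> x y z _ -> _ ->.
- by move=> x x' y y' _ -> _ ->.
- by move=> x x' y y' _ -> _ ->.
- by move=> x y z; rewrite addrA.
- by move=> x y; rewrite addrC.
- by move=> x; rewrite add0r.
- by move=> x y z; rewrite mulrA.
- by move=> x; rewrite mul1r.
- by move=> x; rewrite mul0r.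
- by move=> x y z; rewrite mulrDl.
- by move=> x y z; rewrite mulrDr.
- by move=> a x; rewrite mulrC.
Qed.

Definition pres_char (u : presented_alg) : K := term_char (pres_repr u).

Lemma pres_char_class x : pres_char (pres_class x) = term_char x.
Proof. exact/esym/term_char_eqv/pres_repr_eqv. Qed.

Lemma pres_nontrivial : (1 : presented_alg) != 0.
Proof.
apply/eqP => /(congr1 pres_char).
rewrite -pres_class1 -pres_class0 !pres_char_class /= => /eqP.
by rewrite oner_eq0.
Qed.

Lemma pres_charZD a u v : pres_char (a *: u + v) = a * pres_char u + pres_char v.
Proof.
have [[x ->] [y ->]] := conj (pres_class_surj u) (pres_class_surj v).
by rewrite -pres_classZ -pres_classD !pres_char_class.
Qed.

Lemma pres_charM u v : pres_char (u * v) = pres_char u * pres_char v.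
Proof.
have [[x ->] [y ->]] := conj (pres_class_surj u) (pres_class_surj v).
by rewrite -pres_classM !pres_char_class.
Qed.

Lemma pres_char1 : pres_char 1 = 1.
Proof. by rewrite -pres_class1 pres_char_class. Qed.

End Characters.

End PresentedAlgebra.

(* U (x) V is presented as the algebra generated by commuting copies          *)
(* u (x) 1 of U and 1 (x) v of V; then u (x) v = (u (x) 1)(1 (x) v).          *)
Section TensorProduct.
Variables (K : fieldType) (U V : algType K).

Local Notation L u := (@alg_var K (U + V)%type (inl u)).
Local Notation R v := (@alg_var K (U + V)%type (inr v)).

Inductive tensor_relation :
    alg_term K (U + V)%type -> alg_term K (U + V)%type -> Prop :=
| tensor_linl a u1 u2 : tensor_relation (L (a *: u1 + u2)) (a *: L u1 + L u2)%T
| tensor_onel : tensor_relation (L 1) (alg_const 1)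
| tensor_mull u1 u2 : tensor_relation (L (u1 * u2)) (L u1 * L u2)%T
| tensor_linr a v1 v2 : tensor_relation (R (a *: v1 + v2)) (a *: R v1 + R v2)%T
| tensor_oner : tensor_relation (R 1) (alg_const 1)
| tensor_mulr v1 v2 : tensor_relation (R (v1 * v2)) (R v1 * R v2)%T
| tensor_comm u v : tensor_relation (L u * R v)%T (R v * L u)%T.

Definition tensor_alg : Type := presented_alg tensor_relation.
HB.instance Definition _ := GRing.PzRing.on tensor_alg.
HB.instance Definition _ := GRing.Lmodule.on tensor_alg.

Definition tensor (u : U) (v : V) : tensor_alg :=
  pres_gen tensor_relation (inl u) * pres_gen tensor_relation (inr v).

(* The image U (x) B of a subset B of V, when B is a subspace. *)
Definition tensor_right (B : set V) : set tensor_alg :=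
  [set t | exists s : seq (U * V),
     (forall uv, uv \in s -> B uv.2) /\ t = \sum_(uv <- s) tensor uv.1 uv.2].

Lemma tensor_nontrivial (cU : U -> K) (cV : V -> K) :
    (forall a x y, cU (a *: x + y) = a * cU x + cU y) ->
    (forall x y, cU (x * y) = cU x * cU y) -> cU 1 = 1 ->
    (forall a x y, cV (a *: x + y) = a * cV x + cV y) ->
    (forall x y, cV (x * y) = cV x * cV y) -> cV 1 = 1 ->
  (1 : tensor_alg) != 0.
Proof.
move=> cUZD cUM cU1 cVZD cVM cV1.
pose eps (x : (U + V)%type) := match x with inl u => cU u | inr v => cV v end.
apply: (@pres_nontrivial _ _ _ eps) => x y.
by case=> * /=; rewrite ?(cUZD, cUM, cVZD, cVM) // mulrC.
Qed.

End TensorProduct.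

Inductive lie_term (K X : Type) : Type :=
| lie_var of X
| lie_zero
| lie_add of lie_term K X & lie_term K X
| lie_scale of K & lie_term K X
| lie_br of lie_term K X & lie_term K X.
Arguments lie_var {K X}.
Arguments lie_zero {K X}.

Section LieTermChoice.
Variables K X : Type.
HB.instance Definition _ := gen_eqMixin (lie_term K X).
HB.instance Definition _ := gen_choiceMixin (lie_term K X).
End LieTermChoice.

Section PresentedLieAlgebra.
Variables (K : fieldType) (X : Type).
Local Notation term := (lie_term K X).
Variable R : term -> term -> Prop.

Inductive lie_eqv : term -> term -> Prop :=
| lie_refl x : lie_eqv x x
| lie_sym x y : lie_eqv x y -> lie_eqv y x
| lie_trans x y z : lie_eqv x y -> lie_eqv y z -> lie_eqv x z
| lie_congD x x' y y' :
    lie_eqv x x' -> lie_eqv y y' -> lie_eqv (lie_add x y) (lie_add x' y')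
| lie_congZ a x x' : lie_eqv x x' -> lie_eqv (lie_scale a x) (lie_scale a x')
| lie_congB x x' y y' :
    lie_eqv x x' -> lie_eqv y y' -> lie_eqv (lie_br x y) (lie_br x' y')
| lie_addA x y z :
    lie_eqv (lie_add x (lie_add y z)) (lie_add (lie_add x y) z)
| lie_addC x y : lie_eqv (lie_add x y) (lie_add y x)
| lie_add0 x : lie_eqv (lie_add lie_zero x) x
| lie_addN x : lie_eqv (lie_add (lie_scale (-1) x) x) lie_zero
| lie_scaleA a b x : lie_eqv (lie_scale a (lie_scale b x)) (lie_scale (a * b) x)
| lie_scale1 x : lie_eqv (lie_scale 1 x) x
| lie_scaleDr a x y :
    lie_eqv (lie_scale a (lie_add x y)) (lie_add (lie_scale a x) (lie_scale a y))
| lie_scaleDl a b x :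
    lie_eqv (lie_scale (a + b) x) (lie_add (lie_scale a x) (lie_scale b x))
| lie_brDl x y z :
    lie_eqv (lie_br (lie_add x y) z) (lie_add (lie_br x z) (lie_br y z))
| lie_brZl a x y : lie_eqv (lie_br (lie_scale a x) y) (lie_scale a (lie_br x y))
| lie_brDr x y z :
    lie_eqv (lie_br x (lie_add y z)) (lie_add (lie_br x y) (lie_br x z))
| lie_brZr a x y : lie_eqv (lie_br x (lie_scale a y)) (lie_scale a (lie_br x y))
| lie_brxx x : lie_eqv (lie_br x x) lie_zero
| lie_jacobi x y z :
    lie_eqv (lie_add (lie_br x (lie_br y z))
              (lie_add (lie_br y (lie_br z x)) (lie_br z (lie_br x y)))) lie_zero
| lie_rel x y : R x y -> lie_eqv x y.

Definition lie_eqb : rel term := fun x y => `[< lie_eqv x y >].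

Lemma lie_eqb_equiv : equiv_class_of lie_eqb.
Proof.
split=> [x|x y|y x z].
- exact/asboolP/lie_refl.
- by apply/asboolP/asboolP => /lie_sym.
- by move=> /asboolP xy /asboolP yz; apply/asboolP/(lie_trans xy yz).
Qed.

Canonical lie_eqb_rel := EquivRelPack lie_eqb_equiv.

Definition presented_lie : Type := {eq_quot lie_eqb}.
HB.instance Definition _ := Choice.on presented_lie.

Definition lie_class : term -> presented_lie :=
  locked_with pres_key (fun x => \pi_({eq_quot lie_eqb}) x).
Definition lie_repr : presented_lie -> term := locked_with pres_key repr.

Lemma lie_class_eq x y : lie_class x = lie_class y <-> lie_eqv x y.
Proof.
rewrite /lie_class locked_withE.
by split=> [/eqquotP/asboolP|?]; last exact/eqquotP/asboolP.
Qed.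

Lemma lie_reprK u : lie_class (lie_repr u) = u.
Proof. by rewrite /lie_class /lie_repr !locked_withE reprK. Qed.

Lemma lie_class_surj (u : presented_lie) : exists x, u = lie_class x.
Proof. by exists (lie_repr u); rewrite lie_reprK. Qed.

Lemma lie_repr_eqv x : lie_eqv x (lie_repr (lie_class x)).
Proof. by apply/lie_class_eq; rewrite lie_reprK. Qed.

Definition plie_zero : presented_lie := lie_class lie_zero.
Definition plie_add : presented_lie -> presented_lie -> presented_lie :=
  locked_with pres_key (fun u v => lie_class (lie_add (lie_repr u) (lie_repr v))).
Definition plie_scale : K -> presented_lie -> presented_lie :=
  locked_with pres_key (fun a u => lie_class (lie_scale a (lie_repr u))).
Definition plie_opp (u : presented_lie) := plie_scale (-1) u.
Definition lie_bracket : presented_lie -> presented_lie -> presented_lie :=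
  locked_with pres_key (fun u v => lie_class (lie_br (lie_repr u) (lie_repr v))).

Lemma lie_classD x y : lie_class (lie_add x y) = plie_add (lie_class x) (lie_class y).
Proof.
by rewrite /plie_add locked_withE; apply/lie_class_eq/lie_congD; apply/lie_repr_eqv.
Qed.

Lemma lie_classZ a x : lie_class (lie_scale a x) = plie_scale a (lie_class x).
Proof.
by rewrite /plie_scale locked_withE; apply/lie_class_eq/lie_congZ/lie_repr_eqv.
Qed.

Lemma lie_classB x y : lie_class (lie_br x y) = lie_bracket (lie_class x) (lie_class y).
Proof.
by rewrite /lie_bracket locked_withE; apply/lie_class_eq/lie_congB; apply/lie_repr_eqv.
Qed.

Lemma plie_addA : associative plie_add.
Proof.
move=> u v w; have [[x ->] [y ->] [z ->]] :=
  And3 (lie_class_surj u) (lie_class_surj v) (lie_class_surj w).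
rewrite -!lie_classD; exact/lie_class_eq/lie_addA.
Qed.

Lemma plie_addC : commutative plie_add.
Proof.
move=> u v; have [[x ->] [y ->]] := conj (lie_class_surj u) (lie_class_surj v).
rewrite -!lie_classD; exact/lie_class_eq/lie_addC.
Qed.

Lemma plie_add0 : left_id plie_zero plie_add.
Proof.
move=> u; have [x ->] := lie_class_surj u.
rewrite -!lie_classD; exact/lie_class_eq/lie_add0.
Qed.

Lemma plie_addN : left_inverse plie_zero plie_opp plie_add.
Proof.
move=> u; have [x ->] := lie_class_surj u.
rewrite /plie_opp -lie_classZ -lie_classD; exact/lie_class_eq/lie_addN.
Qed.

HB.instance Definition _ := GRing.isZmodule.Build presented_lie
  plie_addA plie_addC plie_add0 plie_addN.

Lemma plie_scaleA a b u : plie_scale a (plie_scale b u) = plie_scale (a * b) u.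
Proof.
have [x ->] := lie_class_surj u.
rewrite -!lie_classZ; exact/lie_class_eq/lie_scaleA.
Qed.

Lemma plie_scale1 : left_id 1 plie_scale.
Proof.
move=> u; have [x ->] := lie_class_surj u.
rewrite -lie_classZ; exact/lie_class_eq/lie_scale1.
Qed.

Lemma plie_scaleDr : right_distributive plie_scale +%R.
Proof.
move=> a u v; have [[x ->] [y ->]] := conj (lie_class_surj u) (lie_class_surj v).
rewrite /GRing.add /= -!(lie_classD, lie_classZ).
exact/lie_class_eq/lie_scaleDr.
Qed.

Lemma plie_scaleDl u : {morph plie_scale^~ u : a b / a + b}.
Proof.
move=> a b; have [x ->] := lie_class_surj u.
rewrite [RHS]/GRing.add /= -!(lie_classD, lie_classZ).
exact/lie_class_eq/lie_scaleDl.
Qed.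

HB.instance Definition _ := GRing.Zmodule_isLmodule.Build K presented_lie
  plie_scaleA plie_scale1 plie_scaleDr plie_scaleDl.

Definition lie_gen (x : X) : presented_lie := lie_class (lie_var x).

End PresentedLieAlgebra.

Section KacMoody.
Variables (K : fieldType) (m : nat) (a : 'M[int]_m).

Inductive chevalley_gen : Type :=
| gen_e of 'I_m | gen_f of 'I_m | gen_h of 'I_m.

Local Notation e i := (lie_var (gen_e i)).
Local Notation f i := (lie_var (gen_f i)).
Local Notation h i := (lie_var (gen_h i)).

Inductive serre_relation :
    lie_term K chevalley_gen -> lie_term K chevalley_gen -> Prop :=
| serre_hh i j : serre_relation (lie_br (h i) (h j)) lie_zero
| serre_he i j :
    serre_relation (lie_br (h i) (e j)) (lie_scale (a i j)%:~R (e j))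
| serre_hf i j :
    serre_relation (lie_br (h i) (f j)) (lie_scale (- (a i j)%:~R) (f j))
| serre_ef i j :
    serre_relation (lie_br (e i) (f j)) (if i == j then h i else lie_zero)
| serre_ee i j : i != j ->
    serre_relation (iter `|1 - a i j|%N (lie_br (e i)) (e j)) lie_zero
| serre_ff i j : i != j ->
    serre_relation (iter `|1 - a i j|%N (lie_br (f i)) (f j)) lie_zero.

(* For a of finite type this is the semisimple Lie algebra with Cartan        *)
(* matrix a (Serre); for a of affine type it is the subalgebra of the affine  *)
(* Kac-Moody algebra generated by the Chevalley generators, i.e. its derived  *)
(* algebra, without the degree derivation (Gabber-Kac).                       *)
Definition kac_moody : Type := presented_lie serre_relation.
HB.instance Definition _ := GRing.Lmodule.on kac_moody.

Definition simple_root (i : 'I_m) : 'rV[int]_m := delta_mx 0 i.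

(* The grading by the root lattice Z alpha_1 + ... + Z alpha_m. It refines    *)
(* the weight decomposition under the h_i, which for a degenerate matrix a    *)
(* do not separate the roots.                                                 *)
Inductive root_space : 'rV[int]_m -> kac_moody -> Prop :=
| root_space_e i : root_space (simple_root i) (lie_gen serre_relation (gen_e i))
| root_space_f i :
    root_space (- simple_root i) (lie_gen serre_relation (gen_f i))
| root_space_h i : root_space 0 (lie_gen serre_relation (gen_h i))
| root_space0 b : root_space b 0
| root_space_lin b (c : K) x y :
    root_space b x -> root_space b y -> root_space b (c *: x + y)
| root_space_br b1 b2 (x y : kac_moody) : root_space b1 x -> root_space b2 y ->
    root_space (b1 + b2) (lie_bracket x y).

Definition is_root (b : 'rV[int]_m) : Prop :=
  b != 0 /\ exists x : kac_moody, x != 0 /\ root_space b x.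

(* The order on roots is that of the root lattice: beta <= theta iff          *)
(* theta - beta is a combination of simple roots with coefficients in N.      *)
(* A highest root exists only if a is nonempty and indecomposable.            *)
Definition highest_root (th : 'rV[int]_m) : Prop :=
  is_root th /\ forall b, is_root b -> forall i, b 0 i <= th 0 i.

End KacMoody.

(* Cartan matrices of semisimple Lie algebras, with a i j = <alpha_j, alpha_i^vee>. *)
Definition finite_cartan (n : nat) (a : 'M[int]_n) : Prop :=
  [/\ forall i, a i i = 2,
      forall i j, i != j -> a i j <= 0 &
      exists r : 'I_n -> nat,
        [/\ forall i, (0 < r i)%N,
            forall i j, (r i)%:Z * a i j = (r j)%:Z * a j i &
            forall x : 'rV[int]_n, x != 0 ->
              0 < \sum_i \sum_j (r i)%:Z * a i j * x 0 i * x 0 j]].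

Definition symmetrized (m : nat) (a : 'M[int]_m) (r : 'I_m -> nat) (i j : 'I_m) :
    int :=
  (r i)%:Z * a i j.

Definition affine_lift (n : nat) (b : 'rV[int]_n) : 'rV[int]_n.+1 :=
  \row_i (if unlift ord0 i is Some j then b 0 j else 0).

Definition null_root (n : nat) (th : 'rV[int]_n) : 'rV[int]_n.+1 :=
  simple_root ord0 + affine_lift th.

(* Since alpha_0 = delta - th with delta in the radical of the symmetrized    *)
(* form, the last clause says that alpha_0 pairs with the alpha_j as - th     *)
(* does.                                                                      *)
Definition extended_cartan (n : nat) (a : 'M[int]_n) (th : 'rV[int]_n)
    (ahat : 'M[int]_n.+1) (rhat : 'I_n.+1 -> nat) : Prop :=
  [/\ forall i j, ahat (lift ord0 i) (lift ord0 j) = a i j,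
      ahat ord0 ord0 = 2,
      (forall i, (0 < rhat i)%N) /\ \big[gcdn/0%N]_i rhat i = 1%N,
      forall i j, symmetrized ahat rhat i j = symmetrized ahat rhat j i &
      forall j, \sum_i null_root th 0 i * symmetrized ahat rhat i j = 0].

Section QuantumNumbers.
Variables (K : fieldType) (q : K).

Definition qint (m : nat) : K := (q ^+ m - q ^- m) / (q - q^-1).
Definition qfact (m : nat) : K := \prod_(1 <= i < m.+1) qint i.
Definition qbinom (m k : nat) : K := qfact m / (qfact k * qfact (m - k)).

End QuantumNumbers.

Inductive qgroup_gen (m : nat) : Type :=
| gen_xp of 'I_m | gen_xm of 'I_m | gen_k of 'I_m | gen_kinv of 'I_m.

Section QgroupGenChoice.
Variable m : nat.
HB.instance Definition _ := gen_eqMixin (qgroup_gen m).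
HB.instance Definition _ := gen_choiceMixin (qgroup_gen m).
End QgroupGenChoice.

Section QuantumGroup.
Variables (K : fieldType) (q : K) (m : nat) (a : 'M[int]_m) (r : 'I_m -> nat).

Definition qsub (i : 'I_m) : K := q ^+ r i.

Section Relations.

Local Notation term := (alg_term K (qgroup_gen m)).
Local Notation xp i := (@alg_var K (qgroup_gen m) (gen_xp i)).
Local Notation xm i := (@alg_var K (qgroup_gen m) (gen_xm i)).
Local Notation k i := (@alg_var K (qgroup_gen m) (gen_k i)).
Local Notation kinv i := (@alg_var K (qgroup_gen m) (gen_kinv i)).
Local Notation b := (symmetrized a r).

Definition qserre (x : 'I_m -> term) (i j : 'I_m) : term :=
  let N := `|1 - a i j|%N in
  \big[@alg_add _ _/alg_const 0]_(l < N.+1)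
     (((-1) ^+ l * qbinom (qsub i) N l)%R *: (x i ^+ (N - l) * x j * x i ^+ l))%T.

Inductive qgroup_relation : term -> term -> Prop :=
| qgroup_kkinv i : qgroup_relation (k i * kinv i)%T (alg_const 1)
| qgroup_kinvk i : qgroup_relation (kinv i * k i)%T (alg_const 1)
| qgroup_kk i j : qgroup_relation (k i * k j)%T (k j * k i)%T
| qgroup_kxp i j :
    qgroup_relation (k i * xp j * kinv i)%T ((q ^ b i j)%R *: xp j)%T
| qgroup_kxm i j :
    qgroup_relation (k i * xm j * kinv i)%T ((q ^ (- b i j))%R *: xm j)%T
| qgroup_xpxm i j : qgroup_relation (xp i * xm j - xm j * xp i)%T
    (if i == j then ((qsub i - (qsub i)^-1)^-1)%R *: (k i - kinv i)
     else alg_const 0)%T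
| qgroup_serrep i j : i != j ->
    qgroup_relation (qserre (fun l => xp l) i j) (alg_const 0)
| qgroup_serrem i j : i != j ->
    qgroup_relation (qserre (fun l => xm l) i j) (alg_const 0).

End Relations.

Definition qgroup : Type := presented_alg qgroup_relation.
HB.instance Definition _ := GRing.PzRing.on qgroup.
HB.instance Definition _ := GRing.Lmodule.on qgroup.

Definition counit_gen (x : qgroup_gen m) : K :=
  match x with gen_xp _ | gen_xm _ => 0 | gen_k _ | gen_kinv _ => 1 end.

Lemma counit_relation x y :
  qgroup_relation x y -> term_char counit_gen x = term_char counit_gen y.
Proof.
have serre0 x0 i j : (forall l, term_char counit_gen (x0 l) = 0) ->
    term_char counit_gen (qserre x0 i j) = 0.
  move=> x00; rewrite /qserre.
  apply: (big_ind (fun t => term_char counit_gen t = 0)) => //=.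
    by move=> t1 t2 -> ->; rewrite addr0.
  by move=> l _; rewrite x00 mulr0 mul0r mulr0.
case=> [i|i|i j|i j|i j|i j|i j _|i j _] /=; rewrite ?mulr0 ?mul0r ?mulr1 //.
- by case: eqP => _ /=; rewrite ?mulr1 ?subrr ?mulr0 addr0.
- exact: serre0.
- exact: serre0.
Qed.

HB.instance Definition _ := GRing.PzSemiRing_isNonZero.Build qgroup
  (pres_nontrivial counit_relation).
HB.instance Definition _ := GRing.Lmodule_isLalgebra.Build K qgroup
  (@pres_scalerAl _ _ _).
HB.instance Definition _ := GRing.Lalgebra_isAlgebra.Build K qgroup
  (@pres_scalerAr _ _ _).

Definition qgroup2 : Type := tensor_alg qgroup qgroup.
HB.instance Definition _ := GRing.PzRing.on qgroup2.
HB.instance Definition _ := GRing.Lmodule.on qgroup2.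

Lemma qgroup2_nontrivial : (1 : qgroup2) != 0.
Proof.
pose c : qgroup -> K := pres_char counit_gen.
have cZD a0 (x y : qgroup) : c (a0 *: x + y) = a0 * c x + c y.
  exact: pres_charZD counit_relation a0 x y.
have cM (x y : qgroup) : c (x * y) = c x * c y.
  exact: pres_charM counit_relation x y.
have c1 : c 1 = 1 by exact: pres_char1 counit_relation.
exact: (tensor_nontrivial cZD cM c1 cZD cM c1).
Qed.

HB.instance Definition _ :=
  GRing.PzSemiRing_isNonZero.Build qgroup2 qgroup2_nontrivial.
HB.instance Definition _ := GRing.Lmodule_isLalgebra.Build K qgroup2
  (@pres_scalerAl _ _ _).
HB.instance Definition _ := GRing.Lalgebra_isAlgebra.Build K qgroup2
  (@pres_scalerAr _ _ _).

Definition xp (i : 'I_m) : qgroup := pres_gen qgroup_relation (gen_xp i).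
Definition xm (i : 'I_m) : qgroup := pres_gen qgroup_relation (gen_xm i).
Definition kk (i : 'I_m) : qgroup := pres_gen qgroup_relation (gen_k i).
Definition kinv (i : 'I_m) : qgroup := pres_gen qgroup_relation (gen_kinv i).

Definition is_coproduct (Delta : {lrmorphism qgroup -> qgroup2}) :
    Prop :=
  [/\ forall i, Delta (kk i) = tensor (kk i) (kk i),
      forall i, Delta (xp i) = tensor (xp i) 1 + tensor (kk i) (xp i) &
      forall i, Delta (xm i) = tensor (xm i) (kinv i) + tensor 1 (xm i)].

Definition left_coideal_subalgebra
    (Delta : {lrmorphism qgroup -> qgroup2}) (B : set qgroup) :
    Prop :=
  is_subalgebra B /\ forall b, B b -> tensor_right B (Delta b).

Definition adr_xp (i : 'I_m) (u : qgroup) : qgroup :=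
  kinv i * u * xp i - kinv i * xp i * u.

(* For s = [:: (i_1, m_1); ...; (i_r, m_r)], the right adjoint action of      *)
(* (xi^+_{i_1})^(m_1) ... (xi^+_{i_r})^(m_r), the rightmost factor acting     *)
(* first; the divided power (xi^+_i)^(l) is nu i l times the l-th power.      *)
Definition adr_word (nu : 'I_m -> nat -> K) (s : seq ('I_m * nat)) (u : qgroup) :
    qgroup :=
  foldr (fun im v => nu im.1 im.2 *: iter im.2 (adr_xp im.1) v) u s.

Definition kpow (i : 'I_m) (z : int) : qgroup :=
  match z with Posz l => kk i ^+ l | Negz l => kinv i ^+ l.+1 end.

Definition tau (lam : 'rV[int]_m) : qgroup := \prod_i kpow i (lam 0 i).

End QuantumGroup.

(* The indices i with alpha_i in pi \ {alpha_p}. *)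
Definition fixed_part (n : nat) (p : 'I_n.+1) : pred 'I_n.+1 :=
  [pred i | (i != ord0) && (i != p)].

(* theta is a Lie algebra involution permuting the root spaces by Theta. *)
Definition associated_involution (K : fieldType) (m : nat) (a : 'M[int]_m)
    (theta : {linear kac_moody K a -> kac_moody K a})
    (Theta : {additive 'rV[int]_m -> 'rV[int]_m}) : Prop :=
  [/\ forall x y : kac_moody K a,
        theta (lie_bracket x y) = lie_bracket (theta x) (theta y),
      involutive theta,
      involutive Theta &
      forall b (x : kac_moody K a), root_space b x -> root_space (Theta b) (theta x)].

Definition admissible_lattice_involution (n : nat) (th : 'rV[int]_n)
    (p : 'I_n.+1) (Theta : 'rV[int]_n.+1 -> 'rV[int]_n.+1) : Prop :=
  [/\ exists c : 'I_n.+1 -> int,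
        Theta (simple_root ord0) =
          - simple_root p - \sum_(i | fixed_part p i) simple_root i *~ c i,
      forall i, fixed_part p i -> Theta (simple_root i) = simple_root i &
      simple_root ord0 - Theta (simple_root ord0) =
        null_root th *+ (if p == ord0 then 2 else 1)].

Section CoidealSubalgebra.
Variables (K : fieldType) (q : K) (n : nat) (ahat : 'M[int]_n.+1).
Variables (rhat : 'I_n.+1 -> nat) (p : 'I_n.+1).
Variable Theta : 'rV[int]_n.+1 -> 'rV[int]_n.+1.

Local Notation U := (qgroup q ahat rhat).
Local Notation xp := (xp q ahat rhat).
Local Notation xm := (xm q ahat rhat).
Local Notation kk := (kk q ahat rhat).
Local Notation kinv := (kinv q ahat rhat).
Local Notation tau := (tau q ahat rhat).

(* As q is a scalar, an algebra automorphism with q |-> q^-1 is a ring        *)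
(* automorphism which is semilinear along a field automorphism sigma with     *)
(* sigma q = q^-1.                                                            *)
Record quantum_involution (nu : 'I_n.+1 -> nat -> K) (s : seq ('I_n.+1 * nat))
    (sigma : {rmorphism K -> K}) (thetat : {rmorphism U -> U}) : Prop := {
  qinv_roots : forall im, im \in s -> fixed_part p im.1 && (0 < im.2)%N;
  qinv_Theta : Theta (simple_root ord0) =
    - simple_root p - \sum_(im <- s) simple_root im.1 *+ im.2;
  qinv_sigma : bijective sigma;
  qinv_bij : bijective thetat;
  qinv_semilinear : forall (c : K) (u : U), thetat (c *: u) = sigma c *: thetat u;
  qinv_q : sigma q = q^-1;
  qinv_xp : forall i, fixed_part p i -> thetat (xp i) = xp i;
  qinv_xm : forall i, fixed_part p i -> thetat (xm i) = xm i;
  qinv_tau : forall lam, thetat (tau lam) = tau (Theta (- lam));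
  qinv_xm0 : thetat (xm ord0) = adr_word nu s (kinv p * xp p);
  qinv_xmp : p != ord0 -> thetat (xm p) =
    (-1) ^+ (\sum_(im <- s) im.2)%N *:
      adr_word nu (rev s) (kinv ord0 * xp ord0)
}.

Definition hopf_M : set U :=
  generated_subalgebra [set x : U | exists2 i, fixed_part p i &
     [\/ x = xp i, x = xm i, x = kk i | x = kinv i]].

Definition torus_Theta : set U :=
  [set x : U | exists2 lam, Theta lam = lam & x = tau lam].

(* The indices of hat pi^* = {alpha_0, alpha_p}. *)
Definition pi_star : pred 'I_n.+1 := pred2 ord0 p.

Definition coideal_gen (thetat : U -> U) (d : 'I_n.+1 -> K) (j : 'I_n.+1) : U :=
  xm j * kk j - d j *: (thetat (xm j) * kk j).

Definition coideal_B (thetat : U -> U) (d : 'I_n.+1 -> K) : set U :=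
  generated_subalgebra (hopf_M `|` torus_Theta `|`
    [set x : U | exists2 j, pi_star j & x = coideal_gen thetat d j])%classic.

End CoidealSubalgebra.

(* Main.v *)
Require Import Defs.
From mathcomp Require Import all_boot all_order all_algebra.
From mathcomp Require Import boolp classical_sets reals complex.

Set Implicit Arguments.
Unset Strict Implicit.
Unset Printing Implicit Defensive.

Import Order.TTheory GRing.Theory Num.Theory.
Local Open Scope ring_scope.

(* All d_j = 1 work.  As Delta is an algebra map and U (x) B is a subalgebra,  *)
(* it suffices to consider generators, and only the B^-_j are not immediate.  *)
(* For u = k_i^-1 xi_i^+ the rest Delta u - 1 (x) u lies in U (x) k_i^-1, and *)
(* ad_r xi_l^+ maps the rest of u to that of (ad_r xi_l^+) u by multiplying   *)
(* right tensor factors by xi_l^+ and k_l^-1, which lie in M.  Hence          *)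
(*   Delta(B^-_j) = xi^-_j k_j (x) 1 + k_j (x) B^-_j modulo U (x) B           *)
(* as soon as k_i^-1 k_j lies in T_Theta; this holds for i, j in {0, p(0)}    *)
(* because Theta fixes alpha_0 - alpha_p(0).                                  *)

(** An algebra map pulls the subalgebra U (x) B back to a subalgebra
    ([subalgebra_coproduct_tensor_right]), so only generators matter. In Delta(B^-_j) the summands 1
    (x) xi^-_j and 1 (x) theta(xi^-_j), multiplied by k_j (x) k_j, recombine into k_j (x) B^-_j
    whatever the scalar d_j is. What is left of theta(xi^-_j) is its [coproduct_rest]. It starts as
    u (x) k_i^-1 ([coproduct_rest_kinv_xp]), and ad_r xi^+_l only takes its commutator with
    Delta(xi^+_l) and multiplies by k_l^-1 (x) k_l^-1 ([coproduct_rest_adr_xp]). So its right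
    factors stay among the w with w k_j in B, provided that k_i^-1 k_j is in B; this is where
    [Theta_sub_simple_root0] enters. *)

Section Tensor.

(** * Calculus in U (x) V and in its subsets U (x) W *)

Variables (K : fieldType) (U V : algType K).
Implicit Types (u : U) (v : V) (t : tensor_alg U V) (W : set V).

Local Notation inL u :=
  (pres_gen (@tensor_relation K U V) (inl u) : tensor_alg U V).
Local Notation inR v :=
  (pres_gen (@tensor_relation K U V) (inr v) : tensor_alg U V).

Lemma tensorZDl (c : K) u1 u2 v :
  tensor (c *: u1 + u2) v = c *: tensor u1 v + tensor u2 v.
Proof.
have -> : tensor (c *: u1 + u2) v = (c *: inL u1 + inL u2) * inR v.
  congr (_ * _); apply: etrans (pres_class_rel (tensor_linl _ _ _ _)) _.
  by rewrite pres_classD pres_classZ.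
by rewrite mulrDl -[in LHS]pres_scalerAl.
Qed.

Lemma tensorZDr (c : K) u v1 v2 :
  tensor u (c *: v1 + v2) = c *: tensor u v1 + tensor u v2.
Proof.
have -> : tensor u (c *: v1 + v2) = inL u * (c *: inR v1 + inR v2).
  congr (_ * _); apply: etrans (pres_class_rel (tensor_linr _ _ _ _)) _.
  by rewrite pres_classD pres_classZ.
by rewrite mulrDr -[in LHS]pres_scalerAr.
Qed.

Lemma tensor0r u : tensor u (0 : V) = 0.
Proof.
apply: (@addIr _ (tensor u 0)).
by rewrite -[X in X + _]scale1r -tensorZDr scale1r !add0r.
Qed.

Lemma tensor0l v : tensor (0 : U) v = 0.
Proof.
apply: (@addIr _ (tensor 0 v)).
by rewrite -[X in X + _]scale1r -tensorZDl scale1r !add0r.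
Qed.

Lemma tensorZl (c : K) u v : tensor (c *: u) v = c *: tensor u v.
Proof. by rewrite -[c *: u]addr0 tensorZDl tensor0l addr0. Qed.

Lemma tensorZr (c : K) u v : tensor u (c *: v) = c *: tensor u v.
Proof. by rewrite -[c *: v]addr0 tensorZDr tensor0r addr0. Qed.

Lemma tensorBr u v1 v2 : tensor u (v1 - v2) = tensor u v1 - tensor u v2.
Proof. by rewrite addrC -scaleN1r tensorZDr scaleN1r addrC. Qed.

Lemma tensorM u1 u2 v1 v2 :
  tensor u1 v1 * tensor u2 v2 = tensor (u1 * u2) (v1 * v2).
Proof.
have LM : inL (u1 * u2) = inL u1 * inL u2.
  exact: etrans (pres_class_rel (tensor_mull _ _ _)) (pres_classM _ _ _).
have RM : inR (v1 * v2) = inR v1 * inR v2.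
  exact: etrans (pres_class_rel (tensor_mulr _ _ _)) (pres_classM _ _ _).
have LR : inL u2 * inR v1 = inR v1 * inL u2.
  have := pres_class_rel (tensor_comm u2 v1).
  by rewrite !pres_classM.
have tensorE u v : tensor u v = inL u * inR v by [].
by rewrite !tensorE LM RM -mulrA (mulrA (inR v1)) -LR !mulrA.
Qed.

Lemma tensor11 : tensor (1 : U) (1 : V) = 1.
Proof.
rewrite /tensor.
have -> : inL 1 = 1 by exact/pres_class_rel/tensor_onel.
have -> : inR 1 = 1 by exact/pres_class_rel/tensor_oner.
exact: mulr1.
Qed.

Lemma tensor_right_tensor W u v : W v -> tensor_right W (tensor u v).
Proof.
move=> Wv; exists [:: (u, v)]; rewrite big_seq1; split=> // uv.
by rewrite inE => /eqP ->.
Qed.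

Lemma tensor_rightD W t1 t2 :
  tensor_right W t1 -> tensor_right W t2 -> tensor_right W (t1 + t2).
Proof.
move=> [s1 [s1W ->]] [s2 [s2W ->]]; exists (s1 ++ s2); rewrite big_cat.
by split=> // uv; rewrite mem_cat => /orP[/s1W|/s2W].
Qed.

(* Scalars can be absorbed in the left factor, so W need not be a subspace. *)
Lemma tensor_rightZ W (c : K) t : tensor_right W t -> tensor_right W (c *: t).
Proof.
move=> [s [sW ->]]; exists [seq (c *: uv.1, uv.2) | uv <- s].
split=> [_ /mapP[uv /sW ? ->] //|].
by rewrite big_map scaler_sumr; apply: eq_bigr => uv _; rewrite tensorZl.
Qed.

Lemma tensor_rightB W t1 t2 :
  tensor_right W t1 -> tensor_right W t2 -> tensor_right W (t1 - t2).
Proof.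
move=> W1 W2; apply: tensor_rightD => //.
by rewrite -scaleN1r; apply: tensor_rightZ.
Qed.

Lemma tensor_right_sum W (I : eqType) (r : seq I) (F : I -> tensor_alg U V) :
    (forall i, i \in r -> tensor_right W (F i)) ->
  tensor_right W (\sum_(i <- r) F i).
Proof.
move=> WF; rewrite big_seq; elim/big_ind: _ => //; last exact: tensor_rightD.
by exists [::]; rewrite big_nil.
Qed.

Lemma tensor_right_mull W W' u v t :
    (forall w, W w -> W' (v * w)) ->
  tensor_right W t -> tensor_right W' (tensor u v * t).
Proof.
move=> WW' [s [sW ->]]; rewrite mulr_sumr; apply: tensor_right_sum => uv /sW Wv.
by rewrite tensorM; apply/tensor_right_tensor/WW'.
Qed.

(** Two sets are allowed because right multiplication by k_j has to carry the set of w with w k_j in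
    B into B itself. *)
Lemma tensor_right_mulr W W' u v t :
    (forall w, W w -> W' (w * v)) ->
  tensor_right W t -> tensor_right W' (t * tensor u v).
Proof.
move=> WW' [s [sW ->]]; rewrite mulr_suml; apply: tensor_right_sum => uv /sW Wv.
by rewrite tensorM; apply/tensor_right_tensor/WW'.
Qed.

Lemma tensor_rightM W t1 t2 : (forall v w, W v -> W w -> W (v * w)) ->
  tensor_right W t1 -> tensor_right W t2 -> tensor_right W (t1 * t2).
Proof.
move=> WM [s [sW ->]] Wt; rewrite mulr_suml; apply: tensor_right_sum => uv /sW Wv.
by apply: tensor_right_mull Wt => w; apply: WM.
Qed.

End Tensor.

(** * Subalgebras and generation *)

Section GeneratedSubalgebra.
Variables (K : fieldType) (A : algType K).
Implicit Types S B : set A.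

Lemma generated_subalgebra_is_subalgebra S : is_subalgebra (generated_subalgebra S).
Proof.
split=> [B [[]]|c u v Su Sv B BS|u v Su Sv B BS] //.
  by have [[_ BZD _] _] := BS; apply: BZD; [apply: Su|apply: Sv].
by have [[_ _ BM] _] := BS; apply: BM; [apply: Su|apply: Sv].
Qed.

Lemma subset_generated_subalgebra S : (S `<=` generated_subalgebra S)%classic.
Proof. exact: sub_gen_smallest. Qed.

Lemma generated_subalgebra_sub S B :
  is_subalgebra B -> (S `<=` B)%classic -> (generated_subalgebra S `<=` B)%classic.
Proof. exact: smallest_sub. Qed.

Variables (B : set A) (algB : is_subalgebra B).

Lemma subalgebra1 : B 1. Proof. by case: algB. Qed.

Lemma subalgebraM u v : B u -> B v -> B (u * v).
Proof. by case: algB => _ _; apply. Qed.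

Lemma subalgebraZ c u : B u -> B (c *: u).
Proof.
case: algB => B1 BZD _ Bu.
have B0 : B 0 by rewrite -(addNr 1) -scaleN1r; apply: BZD.
by rewrite -[_ *: _]addr0; apply: BZD.
Qed.

End GeneratedSubalgebra.

(** * Commutation rules of the quantum group *)

Section Qgroup.
Variables (K : fieldType) (q : K) (m : nat) (a : 'M[int]_m) (r : 'I_m -> nat).
Hypothesis q_neq0 : q != 0.

Local Notation U := (qgroup q a r).
Local Notation xp := (xp q a r).
Local Notation xm := (xm q a r).
Local Notation kk := (kk q a r).
Local Notation kinv := (kinv q a r).
Local Notation tau := (tau q a r).
Local Notation b := (symmetrized a r).

Lemma kkV i : kk i * kinv i = 1.
Proof.
exact: etrans (esym (pres_classM _ _ _)) (pres_class_rel (qgroup_kkinv _ _ _ i)).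
Qed.

Lemma kVk i : kinv i * kk i = 1.
Proof.
exact: etrans (esym (pres_classM _ _ _)) (pres_class_rel (qgroup_kinvk _ _ _ i)).
Qed.

Lemma kkC i j : kk i * kk j = kk j * kk i.
Proof.
have := pres_class_rel (qgroup_kk q a r i j).
by rewrite !pres_classM.
Qed.

Lemma kk_xp i j : kk i * xp j = q ^ b i j *: (xp j * kk i).
Proof.
have kxV : kk i * xp j * kinv i = q ^ b i j *: xp j.
  have := pres_class_rel (qgroup_kxp q a r i j).
  by rewrite pres_classZ !pres_classM.
by rewrite scalerAl -kxV -!mulrA kVk mulr1.
Qed.

Lemma xp_kk i j : xp j * kk i = (q ^ b i j)^-1 *: (kk i * xp j).
Proof. by rewrite kk_xp scalerA mulVf ?scale1r // expfz_neq0. Qed.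

Lemma kVkkC i j : kinv i * kk j = kk j * kinv i.
Proof.
by rewrite -[LHS]mulr1 -(kkV i) mulrA -(mulrA (kinv i)) (kkC j) mulrA kVk mul1r.
Qed.

(** * The coproduct on the torus, on adjoint words and on the B^-_j *)

Section Coproduct.
Variable D : U -> tensor_alg U U.
Hypotheses (DZD : forall c u v, D (c *: u + v) = c *: D u + D v).
Hypotheses (DM : forall u v, D (u * v) = D u * D v) (D1 : D 1 = 1).
Hypothesis Dkk : forall i, D (kk i) = tensor (kk i) (kk i).
Hypothesis Dxp : forall i, D (xp i) = tensor (xp i) 1 + tensor (kk i) (xp i).
Hypothesis Dxm : forall i, D (xm i) = tensor (xm i) (kinv i) + tensor 1 (xm i).

Lemma coproductB u v : D (u - v) = D u - D v.
Proof. by rewrite addrC -scaleN1r DZD scaleN1r addrC. Qed.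

Lemma coproductZ c u : D (c *: u) = c *: D u.
Proof.
have D0 : D 0 = 0 by rewrite -(subrr 0) coproductB subrr.
by rewrite -[c *: u]addr0 DZD D0 addr0.
Qed.

(** Not part of the data of Delta: both sides are inverse to Delta(k_i) = k_i (x) k_i. *)
Lemma coproduct_kinv i : D (kinv i) = tensor (kinv i) (kinv i).
Proof.
have TK : tensor (kinv i) (kinv i) * tensor (kk i) (kk i) = 1.
  by rewrite tensorM kVk tensor11.
by rewrite -[LHS]mul1r -TK -mulrA -Dkk -DM kkV D1 mulr1.
Qed.

(** Grouplike elements are closed under products, and [tau lam] is a product of powers of the k_i
    and their inverses. *)
Lemma coproduct_tau lam : D (tau lam) = tensor (tau lam) (tau lam).
Proof.
have grp1 : D 1 = tensor 1 1 by rewrite tensor11.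
have grpM u v : D u = tensor u u -> D v = tensor v v ->
    D (u * v) = tensor (u * v) (u * v).
  by move=> Du Dv; rewrite DM Du Dv tensorM.
have grpX u l : D u = tensor u u -> D (u ^+ l) = tensor (u ^+ l) (u ^+ l).
  by move=> Du; elim: l => // l IHl; rewrite exprS grpM.
apply: (big_ind (fun u => D u = tensor u u)) => // i _.
by case: (lam 0 i) => l; apply: grpX; rewrite ?Dkk ?coproduct_kinv.
Qed.

Lemma subalgebra_coproduct_tensor_right (B : set U) :
  is_subalgebra B -> is_subalgebra [set u | tensor_right B (D u)].
Proof.
move=> algB; split=> /= [|c u v Bu Bv|u v Bu Bv].
- by rewrite D1 -tensor11; apply/tensor_right_tensor/(subalgebra1 algB).
- by rewrite DZD; apply/tensor_rightD/Bv/tensor_rightZ.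
- by rewrite DM; apply: tensor_rightM Bu Bv => w1 w2; apply: subalgebraM.
Qed.

(** The summand 1 (x) u is split off because its right factor need not lie in B; it is absorbed
    later into k_j (x) B^-_j. *)
Definition coproduct_rest (u : U) : tensor_alg U U := D u - tensor 1 u.

Lemma coproduct_restE u : D u = tensor 1 u + coproduct_rest u.
Proof. by rewrite addrC subrK. Qed.

Lemma coproduct_restZ c u : coproduct_rest (c *: u) = c *: coproduct_rest u.
Proof. by rewrite /coproduct_rest coproductZ tensorZr scalerBr. Qed.

Lemma coproduct_rest_kinv_xp i :
  coproduct_rest (kinv i * xp i) = tensor (kinv i * xp i) (kinv i).
Proof.
apply/(canLR (addrK _)).
by rewrite DM coproduct_kinv Dxp mulrDr !tensorM mulr1 kVk.
Qed.

Lemma coproduct_rest_adr_xp i u :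
  coproduct_rest (adr_xp i u) =
    tensor (kinv i) (kinv i) *
      (coproduct_rest u * D (xp i) - D (xp i) * coproduct_rest u).
Proof.
apply/(canLR (addrK _)).
have split_commutator (A : pzRingType) (t x e f : A) :
    t * (e + f) * x - t * x * (e + f) = t * (f * x - x * f) + t * (e * x - x * e).
  rewrite -!mulrA -mulrBr -mulrDr; congr (_ * _).
  by rewrite mulrDl mulrDr opprD addrACA addrC.
rewrite /adr_xp coproductB !DM coproduct_kinv (coproduct_restE u) split_commutator.
(* The cross terms xi^+_i (x) u of the two products cancel; after multiplication by k_i^-1 (x)
   k_i^-1 exactly 1 (x) (ad_r xi^+_i) u remains. *)
have -> : tensor 1 u * D (xp i) - D (xp i) * tensor 1 u =
    tensor (kk i) (u * xp i - xp i * u).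
  rewrite Dxp [LHS]addrC mulrDl mulrDr !tensorM !mulr1 !mul1r opprD.
  by rewrite addrACA addNr add0r addrC tensorBr.
by rewrite tensorM kVk [kinv i * (_ - _)]mulrBr 2![kinv i * (_ * _)]mulrA.
Qed.

(** Each letter multiplies right factors only by xi^+ on either side and by k^-1 on the left. [W] is
    an arbitrary set, since the one used below is not a subalgebra in general. *)
Lemma coproduct_rest_adr_word (W : set U) nu s u :
    {in s, forall im w, W w ->
      [/\ W (kinv im.1 * w), W (xp im.1 * w) & W (w * xp im.1)]} ->
    tensor_right W (coproduct_rest u) ->
  tensor_right W (coproduct_rest (adr_word nu s u)).
Proof.
move=> sW Wu; elim: s sW => //= im s IHs sW.
have /IHs {IHs} : {in s, forall im w, W w ->
    [/\ W (kinv im.1 * w), W (xp im.1 * w) & W (w * xp im.1)]}.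
  by move=> im' s_im'; apply: sW; rewrite inE s_im' orbT.
move: (adr_word _ _ _) => v Wv.
rewrite coproduct_restZ; apply: tensor_rightZ.
have {}sW := sW im (mem_head _ _).
elim: im.2 => //= l; move: (iter _ _ _) => {Wv}v Wv.
rewrite coproduct_rest_adr_xp.
apply: (tensor_right_mull (W := W)) => [w /sW[] //|].
move: (coproduct_rest v) Wv => t Wt; rewrite Dxp mulrDl mulrDr.
apply: tensor_rightB; apply: tensor_rightD.
- by apply: tensor_right_mulr Wt => w; rewrite mulr1.
- by apply: tensor_right_mulr Wt => w /sW[].
- by apply: tensor_right_mull Wt => w; rewrite mul1r.
- by apply: tensor_right_mull Wt => w /sW[].
Qed.

(** Here [u] plays the role of theta(xi^-_j). The factor k_j (x) k_j turns xi^-_j (x) k_j^-1 into a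
    term with right factor 1, and multiplies the right factors of the rest by k_j. *)
Lemma tensor_right_coproduct_xm (B : set U) c j u :
    is_subalgebra B -> B (xm j * kk j - c *: (u * kk j)) ->
    tensor_right [set w | B (w * kk j)] (coproduct_rest u) ->
  tensor_right B (D (xm j * kk j - c *: (u * kk j))).
Proof.
move=> algB Bj Wu; set x := _ - _ in Bj *.
have -> : D x = tensor (xm j * kk j) 1 + tensor (kk j) x
    - c *: (coproduct_rest u * tensor (kk j) (kk j)).
  rewrite coproductB coproductZ !DM Dxm Dkk (coproduct_restE u) !mulrDl !tensorM.
  rewrite kVk !mul1r scalerDr opprD addrA -[c *: tensor _ _]tensorZr.
  by rewrite tensorBr addrA.
apply: tensor_rightB; first apply: tensor_rightD.
- exact/tensor_right_tensor/(subalgebra1 algB).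
- exact: tensor_right_tensor.
- by apply: tensor_rightZ; apply: tensor_right_mulr Wu.
Qed.

(** The index [p] is arbitrary here: the lemma serves for [j] = 0 with p(0), and for [j] = p(0) with
    0 in its place. *)
Lemma tensor_right_coproduct_coideal_gen (B : set U) c nu s p j :
    is_subalgebra B -> {in s, forall im, B (kinv im.1) /\ B (xp im.1)} ->
    B (kinv p * kk j) ->
    let u := adr_word nu s (kinv p * xp p) in
    B (xm j * kk j - c *: (u * kk j)) ->
  tensor_right B (D (xm j * kk j - c *: (u * kk j))).
Proof.
move=> algB sB Bpj u Bj; apply: tensor_right_coproduct_xm => //.
apply: coproduct_rest_adr_word; last first.
  by rewrite coproduct_rest_kinv_xp; apply: tensor_right_tensor.
(* Left stability is clear; on the right, w xi^+ k_j is a scalar multiple of (w k_j) xi^+. *)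
move=> im /sB[Bk Bx] w /= Bw; split; rewrite -mulrA ?xp_kk.
- exact: (subalgebraM algB).
- exact: (subalgebraM algB).
- by rewrite -scalerAr mulrA; apply/(subalgebraZ algB)/(subalgebraM algB).
Qed.

End Coproduct.

End Qgroup.

(** * Torus elements fixed by Theta *)

Section ThetaFixed.
Variables (K : fieldType) (q : K) (n : nat) (a : 'M[int]_n.+1).
Variables (r : 'I_n.+1 -> nat) (p : 'I_n.+1).

Lemma tau_supp2 (lam : 'rV[int]_n.+1) : p != ord0 ->
    (forall i, fixed_part p i -> lam 0 i = 0) ->
  tau q a r lam = kpow q a r ord0 (lam 0 ord0) * kpow q a r p (lam 0 p).
Proof.
move=> p0 lam0; rewrite /tau big_ord_recl.
case: (unliftP ord0 p) p0 lam0 => [j ->|->] p0 lam0; last by rewrite eqxx in p0.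
rewrite (big_only1 j) // => i ij _; rewrite lam0 //=.
Qed.

Lemma tau_sub_simple_root (i j : 'I_n.+1) :
    i != j -> pi_star p i -> pi_star p j ->
  tau q a r (simple_root i - simple_root j) = kk q a r i * kinv q a r j.
Proof.
move=> ij; rewrite /pi_star /= => pi pj.
have p0 : p != ord0.
  by apply: contraNneq ij => p0; move: pi pj; rewrite p0 !orbb => /eqP-> /eqP->.
rewrite tau_supp2 // => [|l /andP[/= l0 lp]]; last first.
  rewrite !mxE !eqxx /=.
  by case/orP: pi => /eqP->; case/orP: pj => /eqP->; rewrite ?(negPf l0) ?(negPf lp).
rewrite !mxE !eqxx /=; have /negPf p0' := p0; rewrite eq_sym in p0.
case/orP: pi ij => /eqP->; case/orP: pj => /eqP->; rewrite ?eqxx // => _.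
  by rewrite ?(negPf p0) ?p0' /= ?expr1.
(* The product [tau] lists index 0 first, so for [i] = p(0) the two factors come out in the opposite
   order. *)
by rewrite ?(negPf p0) ?p0' /= kVkkC ?expr1.
Qed.

(** With [S] the fixed part of - Theta(alpha_0), involutivity turns Theta(alpha_0) = - alpha_p - S
    into Theta(alpha_p) = - alpha_0 - S, and [S] cancels in the difference. *)
Lemma Theta_sub_simple_root0 (Theta : {additive 'rV[int]_n.+1 -> 'rV[int]_n.+1})
    (c : 'I_n.+1 -> int) :
    involutive Theta ->
    Theta (simple_root ord0) =
      - simple_root p - \sum_(i | fixed_part p i) simple_root i *~ c i ->
    (forall i, fixed_part p i -> Theta (simple_root i) = simple_root i) ->
  Theta (simple_root ord0 - simple_root p) = simple_root ord0 - simple_root p.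
Proof.
move=> ThetaK Theta0 Thetai; set S := \sum_(i | _) _ in Theta0.
have ThetaS : Theta S = S.
  by rewrite raddf_sum; apply: eq_bigr => i /Thetai Ti; rewrite raddfMz Ti.
have Thetap : Theta (simple_root p) = - simple_root ord0 - S.
  have : Theta (Theta (simple_root ord0)) = simple_root ord0 by apply: ThetaK.
  rewrite Theta0 raddfB raddfN ThetaS => <-.
  by rewrite opprD !opprK addrK.
by rewrite raddfB Theta0 Thetap opprD !opprK [RHS]addrC addrACA addNr addr0.
Qed.

End ThetaFixed.

Theorem proposition1p2 (R : realType) (q : R[i])
  (hq0 : q != 0) (hq : ~ algebraicOver (ratr : rat -> R[i]) q)
  (n : nat) (a : 'M[int]_n) (ha : finite_cartan a)
  (th : 'rV[int]_n) (hth : highest_root R[i] a th)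
  (ahat : 'M[int]_n.+1) (rhat : 'I_n.+1 -> nat)
  (hahat : extended_cartan a th ahat rhat)
  (Delta : {lrmorphism qgroup q ahat rhat -> qgroup2 q ahat rhat})
  (hDelta : is_coproduct Delta)
  (p : 'I_n.+1)
  (theta : {linear kac_moody R[i] ahat -> kac_moody R[i] ahat})
  (Theta : {additive 'rV[int]_n.+1 -> 'rV[int]_n.+1})
  (htheta : associated_involution theta Theta)
  (hTheta : admissible_lattice_involution th p Theta)
  (nu : 'I_n.+1 -> nat -> R[i]) (hnu : forall i l, nu i l != 0)
  (s : seq ('I_n.+1 * nat))
  (sigma : {rmorphism R[i] -> R[i]})
  (thetat : {rmorphism qgroup q ahat rhat -> qgroup q ahat rhat})
  (hthetat : quantum_involution p Theta nu s sigma thetat) :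
  exists d : 'I_n.+1 -> R[i],
    (forall j, pi_star p j -> d j != 0) /\
    left_coideal_subalgebra Delta (coideal_B p Theta thetat d).
Proof.
have [Dk Dxp Dxm] := hDelta.
have [qroots _ _ _ _ _ _ _ _ qxm0 qxmp] := hthetat.
have [_ _ ThetaK _] := htheta; have [[c Theta0] Thetai _] := hTheta.
exists (fun=> 1); split=> [j _|]; first exact: oner_neq0.
set B := coideal_B _ _ _ _; rewrite /left_coideal_subalgebra.
(* [Delta] is retyped with codomain [tensor_alg], on which the tensor calculus is stated. *)
pose D : qgroup q ahat rhat -> tensor_alg (qgroup q ahat rhat) (qgroup q ahat rhat) :=
  Delta.
have DZD e u v : D (e *: u + v) = e *: D u + D v by exact: linearP.
have DM u v : D (u * v) = D u * D v by exact: rmorphM.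
have D1 : D 1 = 1 by exact: rmorph1.
have algB : is_subalgebra B by exact: generated_subalgebra_is_subalgebra.
have BM : (hopf_M p `<=` B)%classic.
  by move=> x Mx; apply: subset_generated_subalgebra; left; left.
have Btau lam : Theta lam = lam -> B (tau q ahat rhat lam).
  by move=> ?; apply: subset_generated_subalgebra; left; right; exists lam.
have Bgen j : pi_star p j -> B (coideal_gen thetat (fun=> 1) j).
  by move=> ?; apply: subset_generated_subalgebra; right; exists j.
have Bfixed i : fixed_part p i ->
    [/\ B (xp q ahat rhat i), B (xm q ahat rhat i),
        B (kk q ahat rhat i) & B (kinv q ahat rhat i)].
  move=> fi; split; apply: BM; apply: subset_generated_subalgebra; exists i => //.
  - exact: Or41.
  - exact: Or42.
  - exact: Or43.
  - exact: Or44.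
have Thetap := Theta_sub_simple_root0 ThetaK Theta0 Thetai.
have Bkk i j : pi_star p i -> pi_star p j -> B (kinv q ahat rhat i * kk q ahat rhat j).
  (* Equal indices, in particular p(0) = 0, give 1; otherwise the element is [tau] of alpha_j -
     alpha_i = +-(alpha_0 - alpha_p). *)
  move=> pi pj; have [->|ij] := eqVneq i j; first by rewrite kVk; apply: subalgebra1.
  rewrite kVkkC -(@tau_sub_simple_root _ _ _ _ _ p) 1?eq_sym //; apply: Btau.
  case/orP: pi ij => /eqP->; case/orP: pj => /eqP->; rewrite ?eqxx // => _.
  by rewrite -opprB raddfN Thetap.
have algP := subalgebra_coproduct_tensor_right DZD DM D1 algB.
split=> //; apply: (generated_subalgebra_sub algP) => x [[Mx|]|].
(* M is itself a generated subalgebra, so the same reduction leaves only its generators. *)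
- apply: (generated_subalgebra_sub algP) x Mx => x [i fi].
  have [Bx Bm Bk BV] := Bfixed i fi.
  case=> ->; rewrite /= /D; rewrite ?Dxp ?Dxm ?Dk.
  + by apply: tensor_rightD; apply: tensor_right_tensor => //; apply: subalgebra1.
  + by apply: tensor_rightD; apply: tensor_right_tensor.
  + exact: tensor_right_tensor.
  + rewrite [X in tensor_right _ X](coproduct_kinv DM D1 Dk).
    exact: tensor_right_tensor.
- move=> [lam Thetalam ->] /=.
  by rewrite (coproduct_tau DM D1 Dk); apply: tensor_right_tensor; apply: Btau.
have Bs : {in s, forall im, B (kinv q ahat rhat im.1) /\ B (xp q ahat rhat im.1)}.
  by move=> im /qroots/andP[/Bfixed[]].
move=> [j pj ->] /=; have := Bgen j pj; rewrite /coideal_gen.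
have [->|j0] := eqVneq j ord0.
  rewrite qxm0.
  apply: (tensor_right_coproduct_coideal_gen hq0 DZD DM D1 Dk Dxp Dxm) => //.
  by apply: Bkk; rewrite /pi_star /= ?eqxx ?orbT.
move: pj; rewrite /pi_star /= (negPf j0) /= => /eqP jp; rewrite jp in j0 *.
(* The sign (-1)^m of theta(xi^-_p) is absorbed into the scalar, which is arbitrary in the lemma
   applied next. *)
rewrite qxmp // -scalerAl scalerA.
apply: (tensor_right_coproduct_coideal_gen hq0 DZD DM D1 Dk Dxp Dxm) => //.
  by move=> im; rewrite mem_rev; apply: Bs.
by apply: Bkk; rewrite /pi_star /= ?eqxx ?orbT.
Qed.
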